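(* Let $S$ be a factorizable semigroup (i.e. $S=S^2$). Let $\mathsf{FSPA}(S)$ be the category of firm and strong right partial $S$-acts with morphisms of partial $S$-acts, and let $\mathsf{FGA}(S)$ be its full subcategory of firm right global $S$-acts. Let $\mathrm{T}\colon\mathsf{FSPA}(S)\to\mathsf{FGA}(S)$ be the functor given on objects by $\mathrm{T}(A)=A\otimes S$ (with the action $(a\otimes s)*t=a\otimes st$) and on morphisms $f\colon A\to B$ by $\mathrm{T}(f)(a\otimes s)=f(a)\otimes s$. Then $\mathrm{T}$ is a left adjoint to the inclusion functor $\mathrm{I}\colon\mathsf{FGA}(S)\to\mathsf{FSPA}(S)$. Consequently, $\mathsf{FGA}(S)$ is a reflective subcategory of $\mathsf{FSPA}(S)$ with the functor $\mathrm{T}$ being the reflector.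
   Context: A partial map $f\colon X\to Y$ is a map $Z\to Y$ with $Z\subseteq X$; $f(x)$ is defined iff $x\in Z$. All actions are right actions. A global action of $S$ on a set $B$ is a map $*\colon B\times S\to B$ with $(b*s)*t=b*(st)$; then $(B,* )$ is a global $S$-act. A partial action of $S$ on a set $A$ is a partial map $\cdot\colon A\times S\to A$ such that if $a\cdot s$ and $(a\cdot s)\cdot t$ are defined, then $a\cdot st$ is defined and $(a\cdot s)\cdot t=a\cdot st$; then $(A,\cdot)$ is a partial $S$-act. It is strong if whenever $a\cdot s$ and $a\cdot st$ are defined, $(a\cdot s)\cdot t$ is defined and $(a\cdot s)\cdot t=a\cdot st$. It is unitary if for each $a\in A$ there are $b\in A$, $s\in S$ such that $b\cdot s$ is defined and $a=b\cdot s$. Tensor product: for $(a,s),(b,t)\in A\times S$ write $(a,s)\to(b,t)$ if there is $u\in S$ such that $s=ut$ and $a\cdot u$ is defined and equals $b$. Let $\rho$ be the smallest equivalence relation on $A\times S$ containing $\to$; $A\otimes S=(A\times S)/\rho$, and $a\otimes s$ is the $\rho$-class of $(a,s)$. The rule $(a\otimes s)*t=a\otimes st$ is a well-defined global action of $S$ on $A\otimes S$. The partial action $\cdot$ is firm if it is unitary and, whenever $a\cdot s$ and $b\cdot t$ are defined and $a\cdot s=b\cdot t$, one has $a\otimes s=b\otimes t$ in $A\otimes S$. A global action $*$ of $S$ on $B$ is firm if the map $\mu\colon B\otimes S\to B$, $b\otimes s\mapsto b*s$, is bijective; this is a special case of the notion of a firm partial action. When $S=S^2$ and $A$ is firm and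 strong, $A\otimes S$ is a firm global act. A morphism of partial $S$-acts $(A,\cdot)\to(B,\circ)$ is a map $\varphi\colon A\to B$ such that for all $a\in A$, $s\in S$, if $a\cdot s$ is defined then $\varphi(a)\circ s$ is defined and $\varphi(a\cdot s)=\varphi(a)\circ s$. *)

(* Defs.v *)
From HB Require Import structures.
From Stdlib Require Import Relation_Operators.
From mathcomp Require Import all_boot generic_quotient.
From mathcomp Require Import boolp.

Set Implicit Arguments.
Unset Strict Implicit.
Unset Printing Implicit Defensive.

Local Open Scope group_scope.
Local Open Scope quotient_scope.

Record category := Category {
  obj :> Type;
  hom : obj -> obj -> Type;
  idm : forall X, hom X X;
  comp : forall X Y Z, hom Y Z -> hom X Y -> hom X Z;
  comp_idl : forall X Y (f : hom X Y), comp (idm Y) f = f;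
  comp_idr : forall X Y (f : hom X Y), comp f (idm X) = f;
  comp_assoc : forall X Y Z W (h : hom Z W) (g : hom Y Z) (f : hom X Y),
    comp h (comp g f) = comp (comp h g) f
}.

Record functor (C D : category) := Functor {
  fobj :> C -> D;
  fmap : forall X Y : C, hom X Y -> hom (fobj X) (fobj Y);
  fmap_id : forall X : C, fmap (idm X) = idm (fobj X);
  fmap_comp : forall (X Y Z : C) (g : hom Y Z) (f : hom X Y),
    fmap (comp g f) = comp (fmap g) (fmap f)
}.

Definition left_adjoint (C D : category) (F : functor C D) (G : functor D C) :
    Prop :=
  exists phi : forall (X : C) (Y : D), hom (F X) Y -> hom X (G Y),
    [/\ forall X Y, bijective (phi X Y),
        forall (X X' : C) (Y : D) (h : hom X' X) (k : hom (F X) Y),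
          phi X' Y (comp k (fmap F h)) = comp (phi X Y k) h
      & forall (X : C) (Y Y' : D) (g : hom Y Y') (k : hom (F X) Y),
          phi X Y' (comp g k) = comp (fmap G g) (phi X Y k)].

Section FullSubcategory.
Variables (C : category) (P : C -> Prop).

Definition full_subcategory : category :=
  @Category {X : C | P X} (fun X Y => hom (sval X) (sval Y))
    (fun X => idm (sval X)) (fun X Y Z g f => comp g f)
    (fun X Y f => comp_idl f) (fun X Y f => comp_idr f)
    (fun X Y Z W h g f => comp_assoc h g f).

Definition inclusion : functor full_subcategory C :=
  @Functor full_subcategory C (fun X => sval X) (fun X Y f => f)
    (fun X => erefl) (fun X Y Z g f => erefl).

Definition reflector (L : functor C full_subcategory) : Prop :=
  left_adjoint L inclusion.

Definition reflective : Prop :=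
  exists L : functor C full_subcategory, reflector L.

End FullSubcategory.

Definition factorizable (S : semigroupType) : Prop :=
  forall s : S, exists t u : S, s = t * u.

(* A partial map A x S -> A is encoded as act : A -> S -> option A; the
   element "a . s" is defined and equal to b when act a s = Some b. *)

Section Actions.
Variable S : semigroupType.

Definition is_partial_action (A : Type) (act : A -> S -> option A) : Prop :=
  forall (a b c : A) (s t : S),
    act a s = Some b -> act b t = Some c -> act a (s * t) = Some c.

Definition strong (A : Type) (act : A -> S -> option A) : Prop :=
  forall (a b c : A) (s t : S),
    act a s = Some b -> act a (s * t) = Some c -> act b t = Some c.

Definition unitary (A : Type) (act : A -> S -> option A) : Prop :=
  forall a : A, exists (b : A) (s : S), act b s = Some a.

Definition is_global_action (B : Type) (star : B -> S -> B) : Prop :=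
  forall (b : B) (s t : S), star (star b s) t = star b (s * t).

Definition as_partial (B : Type) (star : B -> S -> B) : B -> S -> option B :=
  fun b s => Some (star b s).

Section Tensor.
Variables (A : Type) (act : A -> S -> option A).

Definition arrow (p q : A * S) : Prop :=
  exists u : S, p.2 = u * q.2 /\ act p.1 u = Some q.1.

(* {classic T} is T, equipped with the classical choice structure that
   quotients need. *)
Definition rho : rel {classic (A * S)} :=
  fun p q => `[< clos_refl_sym_trans (A * S) arrow p q >].

Lemma rho_refl : reflexive rho.
Proof. by move=> p; apply/asboolP; exact: rst_refl. Qed.

Lemma rho_sym : symmetric rho.
Proof. by move=> p q; apply/asboolP/asboolP; exact: rst_sym. Qed.

Lemma rho_trans : transitive rho.
Proof.
by move=> q p r /asboolP pq /asboolP qr; apply/asboolP; exact: rst_trans pq qr.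
Qed.

Definition rho_equiv := EquivRel rho rho_refl rho_sym rho_trans.

Definition tensor : Type := {eq_quot rho_equiv}.

Definition tens (a : A) (s : S) : tensor :=
  (\pi_({eq_quot rho_equiv}) ((a, s) : {classic (A * S)}))%qT.

(* The map a (x) s |-> f a s; see tliftE for its well-definedness. *)
Definition tlift (X : Type) (f : A -> S -> X) (c : tensor) : X :=
  let p : A * S := repr (c : {eq_quot rho_equiv}) in f p.1 p.2.

Lemma tens_ind (P : tensor -> Prop) :
  (forall a s, P (tens a s)) -> forall c, P c.
Proof.
move=> H c; rewrite -[c](@reprK _ {eq_quot rho_equiv}).
by case: (repr _) => a s; exact: H.
Qed.

Lemma tens_eqP (a b : A) (s t : S) :
  tens a s = tens b t <-> clos_refl_sym_trans (A * S) arrow (a, s) (b, t).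
Proof.
split=> [/eqmodP/asboolP //|H]; apply/eqmodP; exact/asboolP.
Qed.

Lemma tens_arrow (a b : A) (s t : S) :
  act a s = Some b -> tens a (s * t) = tens b t.
Proof. by move=> h; apply/tens_eqP; apply: rst_step; exists s. Qed.

Lemma tliftE (X : Type) (f : A -> S -> X) :
  (forall a b u t, act a u = Some b -> f a (u * t) = f b t) ->
  forall a s, tlift f (tens a s) = f a s.
Proof.
move=> fP a s; rewrite /tlift.
have : tens a s = tens (repr (tens a s : {eq_quot rho_equiv})).1
                       (repr (tens a s : {eq_quot rho_equiv})).2.
  by rewrite {2}/tens -surjective_pairing reprK.
move: (repr _) => [b t] /= /tens_eqP H.
suff E : forall p q, clos_refl_sym_trans (A * S) arrow p q ->
    f p.1 p.2 = f q.1 q.2 by have /= := E _ _ H.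
move=> p q; elim=> {p q} //; last by move=> p q r _ -> _ ->.
by move=> [p1 p2] [q1 q2] [u /= [-> h]]; exact: fP.
Qed.

Definition tact (c : tensor) (t : S) : tensor :=
  tlift (fun a s => tens a (s * t)) c.

Lemma tactE (a : A) (s t : S) : tact (tens a s) t = tens a (s * t).
Proof.
by rewrite /tact tliftE // => {a s} a b u s h; rewrite -mulgA (tens_arrow _ h).
Qed.

Lemma tact_global : is_global_action tact.
Proof. by elim/tens_ind=> a s t u; rewrite !tactE mulgA. Qed.

Definition firm : Prop :=
  unitary act /\
  forall (a b c : A) (s t : S),
    act a s = Some c -> act b t = Some c -> tens a s = tens b t.

End Tensor.

Definition mu (B : Type) (star : B -> S -> B) : tensor (as_partial star) -> B :=
  tlift star.

Lemma muE (B : Type) (star : B -> S -> B) : is_global_action star ->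
  forall b s, mu (tens (as_partial star) b s) = star b s.
Proof. by move=> starP; apply: tliftE => a b u t [<-]; rewrite starP. Qed.

Definition firm_global (B : Type) (star : B -> S -> B) : Prop :=
  bijective (@mu B star).

Lemma global_partial (B : Type) (star : B -> S -> B) :
  is_global_action star -> is_partial_action (as_partial star).
Proof. by move=> starP a b c s t [<-] [<-]; rewrite /as_partial starP. Qed.

Lemma global_strong (B : Type) (star : B -> S -> B) :
  is_global_action star -> strong (as_partial star).
Proof. by move=> starP a b c s t [<-] [<-]; rewrite /as_partial starP. Qed.

Lemma firm_global_firm (B : Type) (star : B -> S -> B) :
  is_global_action star -> firm_global star -> firm (as_partial star).
Proof.
move=> starP mu_bij; split=> [a|a b c s t [ac] [bc]].
  case: mu_bij => nu _ nuK; rewrite -(nuK a).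
  by elim/tens_ind: (nu a) => b s; exists b, s; rewrite muE.
by apply: (bij_inj mu_bij); rewrite !muE // ac bc.
Qed.

Lemma tact_firm (A : Type) (act : A -> S -> option A) :
  factorizable S -> unitary act -> firm_global (tact (act := act)).
Proof.
move=> Sfact Aunit.
pose T := tens (as_partial (tact (act := act))).
have Tarr c u t : T c (u * t) = T (tact c u) t by exact: tens_arrow.
have Tfact a s t s' t' : s * t = s' * t' ->
    T (tens act a s) t = T (tens act a s') t'.
  move=> st; have [b [u bu]] := Aunit a.
  by rewrite -!(tens_arrow _ bu) -!tactE -!Tarr st.
have Trho p q : clos_refl_sym_trans (A * S) (arrow act) p q ->
    forall s t s' t', p.2 = s * t -> q.2 = s' * t' ->
    T (tens act p.1 s) t = T (tens act q.1 s') t'.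
  elim=> {p q}.
  - move=> [a x] [b y] [u /= [-> au]] s t s' t' e e'.
    rewrite -(tens_arrow _ au); apply: Tfact.
    by rewrite -e e' mulgA.
  - by move=> p s t s' t' -> e; exact: Tfact.
  - by move=> p q _ IH s t s' t' e e'; rewrite (IH s' t' s t).
  - move=> p q r _ IH1 _ IH2 s t s' t' e e'.
    have [x [y xy]] := Sfact q.2.
    by rewrite (IH1 s t x y) // (IH2 x y s' t').
suff H : forall c, exists! d, mu (star := tact (act := act)) d = c.
  pose nu c := projT1 (cid (H c)).
  have nuP c : unique (fun d => mu d = c) (nu c) := projT2 (cid (H c)).
  by exists nu => [d|c]; [apply: (nuP _).2|exact: (nuP c).1].
elim/tens_ind=> a x; have [s [t ->]] := Sfact x.
have muT c u : mu (T c u) = tact c u by rewrite muE //; exact: tact_global.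
exists (T (tens act a s) t); split; first by rewrite muT tactE.
elim/tens_ind=> + t'; elim/tens_ind=> b s'.
rewrite -/(T _ _) muT tactE => /tens_eqP e.
by rewrite (Trho _ _ e s' t' s t).
Qed.

Record fspa_act := FspaAct {
  carrier :> Type;
  pact : carrier -> S -> option carrier;
  pactP : is_partial_action pact;
  pact_firm : firm pact;
  pact_strong : strong pact
}.

Definition is_act_morphism (A B : fspa_act) (f : A -> B) : Prop :=
  forall (a b : A) (s : S), pact a s = Some b -> pact (f a) s = Some (f b).

Record act_morphism (A B : fspa_act) := ActMorphism {
  mor_fun :> A -> B;
  mor_funP : is_act_morphism mor_fun
}.

Lemma act_morphism_eq (A B : fspa_act) (f g : act_morphism A B) :
  f =1 g -> f = g.
Proof.
case: f g => [f fP] [g gP] /= /funext fg; case: g / fg gP => gP.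
by rewrite (Prop_irrelevance fP gP).
Qed.

Definition act_id (A : fspa_act) : act_morphism A A :=
  @ActMorphism A A (fun a => a) (fun a b s h => h).

Definition act_comp (A B C : fspa_act)
    (g : act_morphism B C) (f : act_morphism A B) : act_morphism A C :=
  @ActMorphism A C (fun a => g (f a))
    (fun a b s h => mor_funP g (mor_funP f h)).

Lemma act_comp_idl (A B : fspa_act) (f : act_morphism A B) :
  act_comp (act_id B) f = f.
Proof. exact: act_morphism_eq. Qed.

Lemma act_comp_idr (A B : fspa_act) (f : act_morphism A B) :
  act_comp f (act_id A) = f.
Proof. exact: act_morphism_eq. Qed.

Lemma act_comp_assoc (A B C D : fspa_act) (h : act_morphism C D)
    (g : act_morphism B C) (f : act_morphism A B) :
  act_comp h (act_comp g f) = act_comp (act_comp h g) f.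
Proof. exact: act_morphism_eq. Qed.

Definition FSPA : category :=
  Category act_comp_idl act_comp_idr act_comp_assoc.

Definition is_firm_global (A : FSPA) : Prop :=
  exists star : carrier A -> S -> carrier A,
    [/\ forall a s, pact a s = Some (star a s),
        is_global_action star & firm_global star].

Definition FGA : category := full_subcategory is_firm_global.

Definition inclusion_FGA : functor FGA FSPA := inclusion is_firm_global.

Definition tensor_fspa (Sfact : factorizable S) (A : fspa_act) : fspa_act :=
  let star := tact (act := @pact A) in
  let starP : is_global_action star := @tact_global A (@pact A) in
  @FspaAct (tensor (@pact A)) (as_partial star) (global_partial starP)
    (firm_global_firm starP (tact_firm Sfact (pact_firm A).1))
    (global_strong starP).

Lemma tensor_fspa_firm_global (Sfact : factorizable S) (A : fspa_act) :
  is_firm_global (tensor_fspa Sfact A).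
Proof.
exists (tact (act := @pact A)); split=> //; first exact: tact_global.
exact: tact_firm Sfact (pact_firm A).1.
Qed.

Definition tensor_map (A B : fspa_act) (f : act_morphism A B) :
    tensor (@pact A) -> tensor (@pact B) :=
  tlift (fun a s => tens (@pact B) (f a) s).

Lemma tensor_mapE (A B : fspa_act) (f : act_morphism A B) (a : A) (s : S) :
  tensor_map f (tens (@pact A) a s) = tens (@pact B) (f a) s.
Proof.
apply: tliftE => {a s} a b u t h; exact: tens_arrow (mor_funP f h).
Qed.

Lemma tensor_map_morphism (Sfact : factorizable S) (A B : fspa_act)
    (f : act_morphism A B) :
  @is_act_morphism (tensor_fspa Sfact A) (tensor_fspa Sfact B) (tensor_map f).
Proof.
move=> c d t [<-]; congr Some; elim/tens_ind: c => a s.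
by rewrite tensor_mapE !tactE tensor_mapE.
Qed.

Definition T_obj (Sfact : factorizable S) (A : FSPA) : FGA :=
  exist is_firm_global (tensor_fspa Sfact A) (tensor_fspa_firm_global Sfact A).

Definition T_map (Sfact : factorizable S) (A B : FSPA) (f : hom A B) :
    hom (T_obj Sfact A) (T_obj Sfact B) :=
  ActMorphism (@tensor_map_morphism Sfact A B f).

Lemma T_map_id (Sfact : factorizable S) (A : FSPA) :
  T_map Sfact (idm A) = idm (T_obj Sfact A).
Proof.
by apply: act_morphism_eq; elim/tens_ind=> a s; rewrite /= tensor_mapE.
Qed.

Lemma T_map_comp (Sfact : factorizable S) (A B C : FSPA)
    (g : hom B C) (f : hom A B) :
  T_map Sfact (comp g f) = comp (T_map Sfact g) (T_map Sfact f).
Proof.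
by apply: act_morphism_eq; elim/tens_ind=> a s; rewrite /= !tensor_mapE.
Qed.

Definition T_functor (Sfact : factorizable S) : functor FSPA FGA :=
  Functor (T_map_id Sfact) (T_map_comp Sfact).

End Actions.

(* Main.v *)
(* The unit of the adjunction sends a = b . s to b (x) s: such b, s exist
   because A is unitary, and the tensor does not depend on them because A is
   firm.  A morphism f from A to a global act B corresponds to the map
   a (x) s |-> f a * s, since a (x) s = eta a * s in the tensor product. *)
Require Import Defs.
From mathcomp Require Import all_boot.
From mathcomp Require Import boolp.

Set Implicit Arguments.
Unset Strict Implicit.
Unset Printing Implicit Defensive.

Local Open Scope group_scope.

Section Unit.
Variables (S : semigroupType) (Sfact : factorizable S).
Implicit Types A B : fspa_act S.

Definition eta_fun A (a : A) : tensor (@pact S A) :=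
  let b := cid ((pact_firm A).1 a) in
  tens (@pact S A) (sval b) (sval (cid (svalP b))).

Lemma eta_funE A (a b : A) (s : S) :
  pact b s = Some a -> eta_fun a = tens (@pact S A) b s.
Proof.
move=> bs; rewrite /eta_fun; case: cid => b' /= bP; case: cid => s' /= b's'.
exact: (pact_firm A).2 b's' bs.
Qed.

(** If [a = b . u], both sides equal [b (x) us]. *)
Lemma tact_eta A (a : A) (s : S) : tact (eta_fun a) s = tens (@pact S A) a s.
Proof.
have [b [u bu]] := (pact_firm A).1 a.
by rewrite (eta_funE bu) tactE (tens_arrow _ bu).
Qed.

Lemma eta_morphism A : @is_act_morphism S A (tensor_fspa Sfact A) (@eta_fun A).
Proof. by move=> a b s ab; rewrite (eta_funE ab) -tact_eta. Qed.

Definition eta A : act_morphism A (tensor_fspa Sfact A) :=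
  ActMorphism (@eta_morphism A).

(** Naturality of the unit: [f] carries a factorization [b . s] of [a] to the factorization
    [f b . s] of [f a]. *)
Lemma tensor_map_eta A B (f : act_morphism A B) (a : A) :
  tensor_map f (eta_fun a) = eta_fun (f a).
Proof.
have [b [s bs]] := (pact_firm A).1 a.
by rewrite (eta_funE bs) tensor_mapE -(eta_funE (mor_funP f bs)).
Qed.

Section Extension.
Variables (A B : fspa_act S) (star : B -> S -> B).
Hypothesis pactE : forall b s, pact b s = Some (star b s).
Hypothesis starP : is_global_action star.

Definition extend_fun (f : act_morphism A B) : tensor (@pact S A) -> B :=
  tlift (fun a s => star (f a) s).

Lemma extend_funE (f : act_morphism A B) (a : A) (s : S) :
  extend_fun f (tens (@pact S A) a s) = star (f a) s.
Proof.
(* Well-definedness: if [a . u = b], then [f b = star (f a) u]. *)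
apply: tliftE => {}a b u t /(mor_funP f); rewrite pactE => -[<-].
by rewrite starP.
Qed.

Lemma extend_morphism (f : act_morphism A B) :
  @is_act_morphism S (tensor_fspa Sfact A) B (extend_fun f).
Proof.
move=> c d t [<-]; elim/tens_ind: c => a s.
by rewrite pactE tactE !extend_funE starP.
Qed.

Definition extend (f : act_morphism A B) :
    act_morphism (tensor_fspa Sfact A) B :=
  ActMorphism (extend_morphism f).

(** The elements [eta a] generate the tensor product, so [k] is determined by its values on them. *)
Lemma comp_etaK : cancel (fun k => act_comp k (eta A)) extend.
Proof.
move=> k; apply: act_morphism_eq; elim/tens_ind=> a s.
(* The action on the tensor product is total, so [erefl] witnesses that [eta a . s] is defined. *)
have := mor_funP k (erefl (pact (eta A a) s)).
by rewrite pactE /= extend_funE tact_eta => -[].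
Qed.

(** At [a = b . s] the composite takes the value [star (f b) s], which is [f a] because [f] is a
    morphism. *)
Lemma extendK : cancel extend (fun k => act_comp k (eta A)).
Proof.
move=> f; apply: act_morphism_eq => a /=.
have [b [s bs]] := (pact_firm A).1 a.
rewrite (eta_funE bs) extend_funE.
by have := mor_funP f bs; rewrite pactE => -[].
Qed.

End Extension.

Lemma T_left_adjoint : left_adjoint (T_functor Sfact) (inclusion_FGA S).
Proof.
(* Composition with [eta] needs no choice of [star], which an object of [FGA] only asserts to exist;
   [star] enters only in proving bijectivity. *)
exists (fun (A : FSPA S) (B : FGA S) (k : hom (T_functor Sfact A) B) =>
  act_comp k (eta A)); split.
- move=> A B; have [star [pactE starP _]] := svalP B.
  exact: Bijective (comp_etaK pactE starP) (extendK pactE starP).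
- move=> A A' B h k; apply: act_morphism_eq => a /=.
  by rewrite tensor_map_eta.
- by move=> A B B' g k; apply: act_morphism_eq.
Qed.

End Unit.

Theorem theorem3p11 (S : semigroupType) (Sfact : factorizable S) :
  [/\ left_adjoint (T_functor Sfact) (inclusion_FGA S),
      reflective (@is_firm_global S)
    & reflector (T_functor Sfact)].
Proof.
have adj := T_left_adjoint Sfact.
by split=> //; exists (T_functor Sfact).
Qed.
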